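(* Let $n=k+m$ with $1\le k<n$, let $N\ge2$, and let $\mathcal H=\sum_{j=1}^{N-1}\check r_j\in\mathrm{End}((\mathbb C^n)^{\otimes N})$. Let $\mathfrak u^{\pm}_{m_1,\dots,m_n}\in(\mathbb C^n)^{\otimes N}$, $\sum_{y}m_y=N$, and the operators $\mathfrak h_x,\mathcal E_x,\mathfrak e_x,\mathfrak f_x$ be as defined in the context, where for $\mathfrak u^+$: $m_x\in\{0,\dots,N\}$ if $x\in[k]$ and $m_x\in\{0,1\}$ if $x\in X_k^+$; and for $\mathfrak u^-$: $m_x\in\{0,\dots,N\}$ if $x\in X_k^+$ and $m_x\in\{0,1\}$ if $x\in[k]$. Then: \begin{enumerate} \item $\mathcal H\,\mathfrak u^{\pm}_{m_1,\dots,m_n}=\pm(N-1)\,\mathfrak u^{\pm}_{m_1,\dots,m_n}$. \item The action of $\mathfrak{gl}_{k,m}$ on $\mathfrak u^\pm_{m_1,\dots,m_n}$ is given by \begin{align*} \mathfrak h_x\,\mathfrak u^\pm_{m_1,\dots,m_n}&=(-1)^{m_x}\,\mathfrak u^\pm_{m_1,\dots,m_n}, & x\in X_k^+,\\ \mathcal E_x\,\mathfrak u^\pm_{m_1,\dots,m_n}&=m_x\,\mathfrak u^\pm_{m_1,\dots,m_n}, & x\in[k],\\ \mathcal E_x\,\mathfrak u^\pm_{m_1,\dots,m_n}&=m_x(-1)^{m_x-1}\,\mathfrak u^\pm_{m_1,\dots,m_n}, & x\in X_k^+,\\ \mathfrak e_x\,\mathfrak u^\pm_{m_1,\dots,m_x,m_{x+1},\dots}&=b^\pm_x\,\mathfrak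 u^\pm_{m_1,\dots,m_x-1,m_{x+1}+1,\dots}, & x\in[n-1],\\ \mathfrak f_x\,\mathfrak u^\pm_{m_1,\dots,m_x,m_{x+1},\dots}&=c^\pm_x\,\mathfrak u^\pm_{m_1,\dots,m_x+1,m_{x+1}-1,\dots}, & x\in[n-1], \end{align*} where \begin{itemize} \item for $x\ne1$: $b^+_x=m_x$, $c^+_x=m_{x+1}$ if $x+1\in[k]$; $b^+_x=(-1)^{m_{x+1}}m_x$, $c^+_x=m_{x+1}$ if $x+1\in X_k^+$; and $b^+_1=1$, $c^+_1=(m_1+1)m_2$; \item for $x\neq n-1$: $b^-_x=m_x$, $c^-_x=m_{x+1}$ if $x+1\in[k]$; $b^-_x=(-1)^{m_{x+1}+m_x-1}m_x$, $c^-_x=m_{x+1}$ if $x+1\in X_k^+$; and $b^-_{n-1}=(-1)^{m_n+m_{n-1}-1}m_{n-1}(m_n+1)$, $c^-_{n-1}=1$. \end{itemize} \end{enumerate}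
   Context: $[n]=\{1,\dots,n\}$, $X_k^+=\{k+1,\dots,n\}$; $e_1,\dots,e_n$ is the standard basis of $\mathbb C^n$ and $e_{x,y}$ are the elementary $n\times n$ matrices. $\check r=\mathrm P-2\sum_{x\in X_k^+}e_{x,x}\otimes e_{x,x}$ with $\mathrm P$ the permutation map on $\mathbb C^n\otimes\mathbb C^n$, and $\check r_j=\mathrm{id}^{\otimes(j-1)}\otimes\check r\otimes\mathrm{id}^{\otimes(N-j-1)}$. $\mathfrak{gl}_{k,m}$ ($k+m=n$) is the unital associative $\mathbb C$-algebra generated by invertible $h_z$, $z\in X_k^+$, and $L_{x,y}$, $x,y\in[n]$, with the relations (where $h_z:=1$ for $z\in[k]$) $[h_x,h_y]=0$; $[L_{x,y},h_z]=2L_{x,y}h_x\delta_{z,x}-2h_yL_{x,y}\delta_{y,z}$ for $z\in X_k^+$; and $[L_{x,y},L_{z,w}]-2L_{x,y}L_{x,w}\delta_{x,z}\mathbf 1_{x\in X_k^+}+2L_{z,y}L_{x,y}\delta_{y,w}\mathbf 1_{y\in X_k^+}=L_{z,y}h_x\delta_{x,w}-h_yL_{x,w}\delta_{y,z}$. It has the coproduct $\Delta(h_x)=h_x\otimes h_x$, $\Delta(L_{x,y})=L_{x,y}\otimes h_x+h_y\otimes L_{x,y}$ (ungraded tensor product), and the fundamental representation $\pi:\mathfrak{gl}_{k,m}\to\mathrm{End}(\mathbb C^n)$, $\pi(L_{x,y})=e_{y,x}$, $\pi(h_x)=d_x$, where $d_x=\mathrm{id}$ for $x\in[k]$ and $d_x=\mathrm{id}-2e_{x,x}$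 for $x\in X_k^+$. It acts on $(\mathbb C^n)^{\otimes N}$ via $\pi^{\otimes N}\Delta^{(N)}$, i.e. through the operators $$\mathfrak h_x=\pi^{\otimes N}\Delta^{(N)}(h_x)=d_x^{\otimes N},\qquad \mathfrak t_{x,y}=\pi^{\otimes N}\Delta^{(N)}(L_{x,y})=\sum_{j=1}^Nd_y^{\otimes(j-1)}\otimes e_{y,x}\otimes d_x^{\otimes(N-j)},$$ and $\mathcal E_x=\mathfrak t_{x,x}$ ($x\in[n]$), $\mathfrak e_x=\mathfrak t_{x,x+1}$, $\mathfrak f_x=\mathfrak t_{x+1,x}$ ($x\in[n-1]$). Let $\mathfrak u^+=e_1^{\otimes N}$, $\mathfrak u^-=e_n^{\otimes N}$ and, for $\sum_xm_x=N$ (ordered products), $$\mathfrak u^+_{m_1,\dots,m_n}=\mathfrak t_{1,n}^{m_n}\mathfrak t_{1,n-1}^{m_{n-1}}\cdots\mathfrak t_{1,3}^{m_3}\mathfrak t_{1,2}^{m_2}\,\mathfrak u^+,\qquad \mathfrak u^-_{m_1,\dots,m_n}=\mathfrak t_{n,n-1}^{m_{n-1}}\mathfrak t_{n,n-2}^{m_{n-2}}\cdots\mathfrak t_{n,2}^{m_2}\mathfrak t_{n,1}^{m_1}\,\mathfrak u^-.$$ On right-hand sides, a vector $\mathfrak u^\pm$ with a negative index is understood to be $0$; a vector with an index $m_x=2$ where only $\{0,1\}$ is allowed is given by the same formula and vanishes because $\mathfrak t_{1,x}^2=0$ for $x\in X_k^+$ and $\mathfrak t_{n,x}^2=0$ for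 $x\in[k]$. *)

(* Defs.v *)
From HB Require Import structures.
From mathcomp Require Import all_boot all_order all_algebra.

Set Implicit Arguments.
Unset Strict Implicit.
Unset Printing Implicit Defensive.

Import Order.TTheory GRing.Theory Num.Theory.
Local Open Scope ring_scope.

(* Indices are 0-based: the paper's x in [n] is the ordinal x - 1 of 'I_n, so
   "x in [k]" reads [x < k] and "x in X_k^+" reads [k <= x].  The same holds
   for the tensor factors j in [N]. *)

(* An index x : 'I_p.-1 stands for a pair of neighbours (x, x + 1) in 'I_p;
   this is used both for x in [n-1] and for the sites j in [N-1]. *)
Definition lo p (x : 'I_p.-1) : 'I_p := widen_ord (leq_pred p) x.

Fact hi_subproof p (x : 'I_p.-1) : (x.+1 < p)%N.
Proof. by rewrite -ltn_predRL. Qed.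

Definition hi p (x : 'I_p.-1) : 'I_p := Ordinal (hi_subproof x).

Section Tensors.
Variable C : fieldType.

(* The N-th tensor power of C^n, as the coordinate functions in the basis
   e_(s 0) (x) ... (x) e_(s (N - 1)) indexed by words s. *)
Definition word n N := {ffun 'I_N -> 'I_n}.
Definition tens n N := {ffun word n N -> C^o}.

Definition ptens n N (u : 'I_N -> 'cV[C]_n) : tens n N :=
  [ffun s : word n N => \prod_i u i (s i) 0].

Section TensorOperators.
Variables n N : nat.

Definition tensop_fun (A : 'I_N -> 'M[C]_n) (v : tens n N) : tens n N :=
  [ffun s : word n N => \sum_(t : word n N) (\prod_i A i (s i) (t i)) * v t].

Fact tensop_is_linear A : linear (tensop_fun A).
Proof.
move=> a u v; apply/ffunP=> s; rewrite !ffunE scaler_sumr -big_split /=.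
apply: eq_bigr => t _; rewrite !ffunE mulrDr; congr (_ + _).
by rewrite /GRing.scale /= mulrCA.
Qed.

HB.instance Definition _ A :=
  GRing.isLinear.Build C (tens n N) (tens n N) *:%R (tensop_fun A)
    (tensop_is_linear A).

(* A_0 (x) A_1 (x) ... (x) A_(N - 1) *)
Definition tensop (A : 'I_N -> 'M[C]_n) : 'End(tens n N) :=
  linfun (tensop_fun A).

Lemma tensop_ptens A u : tensop A (ptens u) = ptens (fun i => A i *m u i).
Proof.
apply/ffunP=> s; rewrite lfunE /= !ffunE.
under [RHS]eq_bigr do rewrite mxE.
rewrite bigA_distr_bigA /=; apply: eq_bigr => t _.
by rewrite ffunE big_split.
Qed.

End TensorOperators.

Section TwoSites.
Variable n : nat.

Definition swap_fun (v : tens n 2) : tens n 2 :=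
  [ffun s : word n 2 => v [ffun i => s (rev_ord i)]].

Fact swap_is_linear : linear swap_fun.
Proof. by move=> a u v; apply/ffunP=> s; rewrite !ffunE. Qed.

HB.instance Definition _ :=
  GRing.isLinear.Build C (tens n 2) (tens n 2) *:%R swap_fun swap_is_linear.

(* The permutation map P on C^n (x) C^n *)
Definition swap : 'End(tens n 2) := linfun swap_fun.

Lemma swap_ptens u : swap (ptens u) = ptens (fun i => u (rev_ord i)).
Proof.
apply/ffunP=> s; rewrite lfunE /= !ffunE (reindex_inj rev_ord_inj) /=.
by apply: eq_bigr => i _; rewrite ffunE rev_ordK.
Qed.

(* s with its letters at the sites j, j + 1 replaced by those of p *)
Definition put2 N (j : 'I_N.-1) (s : word n N) (p : word n 2) : word n N :=
  [ffun i => if i == lo j then p ord0 else if i == hi j then p ord_max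
             else s i].

Definition get2 N (j : 'I_N.-1) (s : word n N) : word n 2 :=
  [ffun i => if i == ord0 then s (lo j) else s (hi j)].

Definition at_sites_fun N (j : 'I_N.-1) (A : 'End(tens n 2)) (v : tens n N) :
    tens n N :=
  [ffun s : word n N => A [ffun p : word n 2 => v (put2 j s p)] (get2 j s)].

Fact at_sites_is_linear N j A : linear (@at_sites_fun N j A).
Proof.
move=> a u v; apply/ffunP=> s; rewrite !ffunE.
set x := (X in A X _); set y := (X in _ = _ *: A X _ + _).
set z := (X in _ = _ + A X _).
have -> : x = a *: y + z by apply/ffunP=> p; rewrite !ffunE.
by rewrite linearP !ffunE.
Qed.

HB.instance Definition _ N j A :=
  GRing.isLinear.Build C (tens n N) (tens n N) *:%R (@at_sites_fun N j A)
    (at_sites_is_linear j A).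

(* id (x) ... (x) A (x) ... (x) id, with A on the tensor factors j, j + 1:
   A acts on the restriction of v to the words which agree with s at all the
   other sites. *)
Definition at_sites N (j : 'I_N.-1) (A : 'End(tens n 2)) : 'End(tens n N) :=
  linfun (at_sites_fun j A).

Lemma at_sites_tensop N (j : 'I_N.-1) (A : 'I_2 -> 'M[C]_n) :
  at_sites j (tensop A) =
  tensop (fun i => if i == lo j then A ord0 else if i == hi j then A ord_max
                   else 1%:M).
Proof.
have lohi : hi j == lo j = false by rewrite -val_eqE /= gtn_eqF.
have injput s : injective (@put2 N j s).
  move=> p q /ffunP e; apply/ffunP=> i.
  have := e (lo j); have := e (hi j); rewrite !ffunE lohi !eqxx => e1 e0.
  case: i => [[|[|//]] hi0].
    by rewrite (_ : Ordinal _ = ord0) //; exact/val_inj.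
  by rewrite (_ : Ordinal _ = ord_max) //; exact/val_inj.
apply/lfunP=> v; apply/ffunP=> s; rewrite !lfunE /= !ffunE lfunE /= !ffunE.
rewrite [RHS](bigID (fun t : word n N => t \in codom (put2 j s))) /=.
rewrite [X in _ + X]big1 ?addr0 => [|t tN]; last first.
  apply/eqP; rewrite mulf_eq0; apply/orP; left; apply/negPn/negP=> nz.
  move/prodf_neq0: nz => h; case/negP: tN; apply/codomP; exists (get2 j t).
  apply/ffunP=> i; rewrite !ffunE /=.
  have := h i isT; case: (i =P lo j) => [->//|_]; case: (i =P hi j) => [->//|_].
  by rewrite mxE; case: (s i =P t i) => [->|_]; rewrite ?eqxx.
rewrite (reindex (put2 j s)) /=; last first.
  exists (get2 j) => t.
    move=> _; apply: (injput s); apply/ffunP=> i.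
    by rewrite !ffunE eqxx /= lohi !eqxx; case: eqP => // _; case: eqP.
  move=> /codomP[p ->]; apply/ffunP=> i.
  by rewrite !ffunE eqxx /= lohi !eqxx; case: eqP => // _; case: eqP.
apply: eq_big => [p|p _]; first by rewrite codom_f.
rewrite ffunE; congr (_ * _).
rewrite big_ord_recl big_ord1 (bigD1 (lo j)) //= (bigD1 (hi j)) ?lohi //=.
rewrite !ffunE /= !lohi !eqxx big1 ?mulr1 => [|i /andP[/negPf il /negPf ih]].
  by rewrite (_ : lift _ _ = ord_max) //; exact/val_inj.
by rewrite il ih !ffunE il ih mxE eqxx.
Qed.

End TwoSites.

Section Model.
Variables k n N : nat.

Definition rcheck : 'End(tens n 2) :=
  swap n -
  2%:R *: \sum_(x : 'I_n | (k <= x)%N) tensop (fun=> delta_mx x x).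

Definition op_H : 'End(tens n N) := \sum_(j : 'I_N.-1) at_sites j rcheck.

Definition dmx (x : 'I_n) : 'M[C]_n :=
  if (x < k)%N then 1%:M else 1%:M - 2%:R *: delta_mx x x.

Definition op_h (x : 'I_n) : 'End(tens n N) := tensop (fun=> dmx x).

(* Images of the generators L_(x,y) under the N-fold coproduct and the
   fundamental representation (note the order e_(y,x)). *)
Definition op_t (x y : 'I_n) : 'End(tens n N) :=
  \sum_(j : 'I_N)
    tensop (fun i : 'I_N => if (i < j)%N then dmx y
                            else if i == j then delta_mx y x else dmx x).

Definition op_E (x : 'I_n) := op_t x x.
Definition op_e (x : 'I_n.-1) := op_t (lo x) (hi x).
Definition op_f (x : 'I_n.-1) := op_t (hi x) (lo x).

(* For a = first index (resp. last index) this is u^+ (resp. u^-): start from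
   e_a (x) ... (x) e_a and apply t_(a,x)^(m_x) for x <> a in increasing order
   of x, the smallest x acting first.  Occupation numbers are integers so that
   the shifted ones make sense; the vector is 0 if one of them is negative. *)
Definition uvec (a : 'I_n) (m : {ffun 'I_n -> int}) : tens n N :=
  if [forall x, 0 <= m x] then
    foldl (fun v x => iter `|m x|%N (op_t a x) v)
      (ptens (fun=> delta_mx a 0)) [seq x <- enum 'I_n | x != a]
  else 0.

Hypothesis hkn : (k < n)%N.

Definition ord_first : 'I_n := Ordinal (leq_ltn_trans (leq0n k) hkn).

Fact ord_last_subproof : (n.-1 < n)%N.
Proof. by rewrite ltn_predL (leq_ltn_trans _ hkn). Qed.

Definition ord_last : 'I_n := Ordinal ord_last_subproof.

Definition uplus := uvec ord_first.
Definition uminus := uvec ord_last.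

End Model.

Section Coefficients.
Variables (k n : nat) (m : {ffun 'I_n -> int}) (x : 'I_n.-1).

Definition bplus : C :=
  if x == 0%N :> nat then 1
  else if (hi x < k)%N then (m (lo x))%:~R
  else (-1) ^ m (hi x) * (m (lo x))%:~R.

Definition cplus : C :=
  if x == 0%N :> nat then (m (lo x) + 1)%:~R * (m (hi x))%:~R
  else (m (hi x))%:~R.

(* [hi x == n.-1] is the paper's x = n - 1 *)
Definition bminus : C :=
  if hi x == n.-1 :> nat then
    (-1) ^ (m (hi x) + m (lo x) - 1) * (m (lo x))%:~R * (m (hi x) + 1)%:~R
  else if (hi x < k)%N then (m (lo x))%:~R
  else (-1) ^ (m (hi x) + m (lo x) - 1) * (m (lo x))%:~R.

Definition cminus : C :=
  if hi x == n.-1 :> nat then 1 else (m (hi x))%:~R.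

End Coefficients.

End Tensors.

(* One unit of occupation moved from x to y *)
Definition transfer n (x y : 'I_n) (m : {ffun 'I_n -> int}) :
    {ffun 'I_n -> int} :=
  [ffun z => m z - (z == x)%:Z + (z == y)%:Z].

Definition admplus k n N (m : {ffun 'I_n -> int}) : Prop :=
  \sum_x m x = N%:Z /\
  forall x : 'I_n, 0 <= m x <= (if (x < k)%N then N%:Z else 1).

Definition admminus k n N (m : {ffun 'I_n -> int}) : Prop :=
  \sum_x m x = N%:Z /\
  forall x : 'I_n, 0 <= m x <= (if (x < k)%N then 1 else N%:Z).

(* Main.v *)
(** In the coordinates indexed by words, the vectors are explicit: up to the
    factor given by the product of the m_x! over the x other than the letter a
    of the reference state (a = 1 or a = n), u^+_m is the indicator function of
    the words in which each letter x occurs m_x times, and u^-_m is the same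
    function times the sign of the number of pairs of sites carrying letters in
    increasing order.  Thus u^+ is symmetric and u^- antisymmetric under
    exchange of neighbouring sites, which gives the eigenvalues of H.  When
    t_(x,y) replaces a letter y by x, the signs of the d-factors combine with
    the change of the inversion sign, letter by letter, into a constant; this
    needs that no letter strictly between x and y occurs.  That holds for the
    neighbours x, y in e_x and f_x, and also while u^-_m is built up, because
    the t_(n,x) act in increasing order of x. *)

Require Import Defs.
From mathcomp Require Import all_boot all_order all_algebra.
From mathcomp Require Import reals complex perm zify ring.

Set Implicit Arguments.
Unset Strict Implicit.
Unset Printing Implicit Defensive.

Import Order.TTheory GRing.Theory Num.Theory.
Local Open Scope ring_scope.

(** * Words, their letter counts, and changes of letters *)

Section Words.
Variables n N : nat.
Implicit Types (s : word n N) (x y z : 'I_n) (m : {ffun 'I_n -> int}).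

Definition replace s (j : 'I_N) x : word n N :=
  [ffun i => if i == j then x else s i].

Definition content s : {ffun 'I_n -> int} :=
  [ffun x => #|[set i | s i == x]|%:Z].

Lemma card_others s j x :
  #|[set i | s i == x]| = ((s j == x) + #|[set i | (i != j) && (s i == x)]|)%N.
Proof.
rewrite (cardsD1 j) inE; congr (_ + _)%N; apply: eq_card => i.
by rewrite !inE.
Qed.

Lemma content_replace s j x :
  content (replace s j x) = transfer (s j) x (content s).
Proof.
apply/ffunP=> z; rewrite !ffunE !(card_others _ j) !ffunE eqxx.
have -> : [set i | (i != j) && (replace s j x i == z)] =
          [set i | (i != j) && (s i == z)].
  by apply/setP=> i; rewrite !inE ffunE; case: eqP.
rewrite !PoszD (eq_sym z (s j)) (eq_sym z x).
by case: (s j == z); case: (x == z); lia.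
Qed.

Lemma eq_transfer x y m m' : (m == transfer x y m') = (transfer y x m == m').
Proof.
apply/eqP/eqP=> [->|<-]; apply/ffunP=> z; by rewrite !ffunE addrK subrK.
Qed.

Lemma sum_transfer x y m : \sum_z transfer x y m z = \sum_z m z.
Proof.
under eq_bigr do rewrite ffunE.
rewrite big_split sumrB /=.
have E (w : 'I_n) : \sum_z (z == w)%:Z = 1 :> int.
  by rewrite (bigD1 w) //= eqxx big1 // => z /negPf->.
by rewrite !E subrK.
Qed.

Lemma replace_id s j : replace s j (s j) = s.
Proof. by apply/ffunP=> i; rewrite ffunE; case: eqP => [->|]. Qed.

Definition exchange s (j : 'I_N.-1) : word n N :=
  [ffun i => s (tperm (lo j) (hi j) i)].

Lemma lo_neq_hi p (j : 'I_p.-1) : lo j != hi j.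
Proof. by rewrite -val_eqE /= neq_ltn ltnSn. Qed.

Lemma exchange_id s j : s (lo j) = s (hi j) -> exchange s j = s.
Proof. by move=> sj; apply/ffunP=> i; rewrite ffunE; case: tpermP => // ->. Qed.

Lemma content_exchange s j : content (exchange s j) = content s.
Proof.
apply/ffunP=> x; rewrite !ffunE; congr Posz.
rewrite -(card_preimset [set i | s i == x] (@perm_inj _ (tperm (lo j) (hi j)))).
by apply: eq_card => i; rewrite !inE ffunE.
Qed.

End Words.

(** Made for diagonal matrices and matrix units: where the row of each [A i] read at [s i] has at
    most one nonzero entry, a single word survives in the sum. *)
Lemma tensop_monomial (C : fieldType) n N (A : 'I_N -> 'M[C]_n) v
    (s t : word n N) :
    (forall i z, z != t i -> A i (s i) z = 0) ->
  tensop A v s = (\prod_i A i (s i) (t i)) * v t.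
Proof.
move=> A0; rewrite lfunE ffunE (bigD1 t) //= [X in _ + X]big1 ?addr0 // => u ut.
have /existsP[i iN] : [exists i, u i != t i].
  rewrite -negb_forall; apply: contra ut => /forallP ut.
  by apply/eqP/ffunP=> i; exact/eqP.
by rewrite (bigD1 i) //= A0 // !mul0r.
Qed.

(** * Coordinates of the operators in the basis of words *)

Section Coordinates.
Variable C : fieldType.
Variables k n N : nat.
Implicit Types (s : word n N) (x y z : 'I_n) (v : tens C n N).
Implicit Types m : {ffun 'I_n -> int}.

Lemma dmxE x y z :
  dmx C k x y z = (y == z)%:R * (-1) ^+ ((k <= x)%N && (y == x)).
Proof.
rewrite /dmx; case: ltnP => _ /=; rewrite !mxE ?mulr1 //.
case: (y =P z) => [<-|yz]; rewrite ?mul1r ?mul0r.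
  case: (y == x); rewrite /= ?mulr0 ?subr0 // mulr1.
  by rewrite mulr2n opprD addrA subrr sub0r.
case: (y =P x) => [yx|_]; case: (z =P x) => [zx|_] /=; rewrite ?mulr0 ?subr0 //.
by case: yz; rewrite yx zx.
Qed.

Lemma op_hE x v s :
  op_h C k N x v s = (\prod_i (-1) ^+ ((k <= x)%N && (s i == x))) * v s.
Proof.
rewrite /op_h (@tensop_monomial _ _ _ _ _ _ s) => [|i z /negPf zs].
  by congr (_ * _); apply: eq_bigr => i _; rewrite dmxE eqxx mul1r.
by rewrite dmxE eq_sym zs mul0r.
Qed.

(** The operator sends e_x to e_y at site j, so the coordinate at s reads v at the word where a
    letter y of s is turned back into x. The diagonal d-factors at the other sites only give
    signs. *)
Lemma op_tE x y v s :
  op_t C k N x y v s =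
  \sum_(j | s j == y)
    (\prod_(i | i != j)
       (-1) ^+ ((if (i < j)%N then (k <= y)%N && (s i == y)
                 else (k <= x)%N && (s i == x)) : bool)) *
    v (replace s j x).
Proof.
rewrite /op_t sum_lfunE sum_ffunE [RHS]big_mkcond /=; apply: eq_bigr => j _.
rewrite (@tensop_monomial _ _ _ _ _ _ (replace s j x)) => [|i z].
  rewrite (bigD1 j) //= ltnn eqxx !ffunE eqxx mxE eqxx andbT.
  case: eqP => _; last by rewrite !mul0r.
  rewrite mul1r; congr (_ * _); apply: eq_bigr => i /negPf ij.
  by rewrite !ffunE ij; case: ifP => _; rewrite dmxE eqxx mul1r.
rewrite ffunE; case: (i =P j) => [->|_] /negPf zs.
  by rewrite /= ltnn mxE zs andbF.
by case: ifP; rewrite dmxE eq_sym zs mul0r.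
Qed.

(** * Closed vectors and the inversion sign *)

Section ClosedForm.
Variable anti : bool.

(** The flag sits in the exponent: for u^+ the product is 1, and both families share their
    proofs. *)
Definition inversion_sign s : C :=
  \prod_(i < N) \prod_(j < N)
    (-1) ^+ ([&& anti, (i < j)%N & (s i < s j)%N] : bool).

(* The letters of occupation number at most 1; [anti] selects u^-. *)
Definition single x := if anti then (x < k)%N else (k <= x)%N.

(** Upper bounds suffice: negative occupation numbers are excluded by the comparison with
    [content s] in [closed_vec]. *)
Definition admissible m :=
  [forall x, single x ==> (m x <= 1)].

Definition closed_vec m : tens C n N :=
  [ffun s : word n N =>
     ((content s == m) && admissible m)%:R * inversion_sign s].

(* The sign picked up when [op_t x y] turns a letter y into x. *)
Definition hop_sign x y m : C :=
  if anti && (x < y)%N then (-1) ^ (m x - 1 + m y) else 1.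

(** Isolates the pairs through site j; the second factor is unchanged when the letter at j is
    replaced. *)
Lemma inversion_sign_split s (j : 'I_N) :
  inversion_sign s =
  (\prod_(i | i != j) (-1) ^+ (anti && (if (i < j)%N then (s i < s j)%N
                                        else (s j < s i)%N) : bool)) *
  \prod_(i | i != j) \prod_(i' | i' != j)
    (-1) ^+ ([&& anti, (i < i')%N & (s i < s i')%N] : bool).
Proof.
rewrite /inversion_sign (bigD1 j) //= (bigD1 j) //= ltnn andbF mul1r.
under [X in _ * X]eq_bigr => i _ do rewrite (bigD1 j) //=.
rewrite big_split mulrA -big_split /=; congr (_ * _).
apply: eq_bigr => i; rewrite -val_eqE /= -signr_addb => ij; congr (_ ^+ _).
by case: ltngtP ij => //=; rewrite ?andbF ?addbF.
Qed.

Lemma inversion_sign_replace s (j : 'I_N) x :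
  inversion_sign (replace s j x) =
  (\prod_(i | i != j) (-1) ^+ (anti && (if (i < j)%N
       then (s i < x)%N (+) (s i < s j)%N
       else (x < s i)%N (+) (s j < s i)%N) : bool)) * inversion_sign s.
Proof.
rewrite !(inversion_sign_split _ j) mulrA -[X in _ = X * _]big_split /=;
  congr (_ * _).
  apply: eq_bigr => i /negPf ij; rewrite !ffunE eqxx ij -signr_addb.
  congr (_ ^+ _); case: anti => //=; case: ifP => _; by rewrite addbK.
apply: eq_bigr => i /negPf ij; apply: eq_bigr => i' /negPf ij'.
by rewrite !ffunE ij ij'.
Qed.

(** * Hop signs and the action of the generators on closed vectors *)

Lemma prod_sign_card (P : pred 'I_N) j :
  \prod_(i | i != j) (-1) ^+ (P i : bool) =
  (-1) ^+ #|[set i | (i != j) && P i]| :> C.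
Proof.
by rewrite prodrXr -sum1dep_card big_mkcondr; congr (_ ^+ _).
Qed.

(** Since m counts letters with x placed at j, the other sites carry m_x - 1 letters x and m_y
    letters y. Written as a product over sites, the sign can be compared factor by factor. *)
Lemma hop_sign_prod s j x y m :
    s j = y -> x != y -> content (replace s j x) = m ->
  hop_sign x y m =
  \prod_(i | i != j)
    (-1) ^+ ([&& anti, (x < y)%N & (s i == x) (+) (s i == y)] : bool).
Proof.
move=> sj xy <-; rewrite /hop_sign.
under [RHS]eq_bigr => i _ do rewrite andbA.
case: ifP => /= _; last by rewrite big1.
under eq_bigr => i _ do rewrite signr_addb.
rewrite big_split /= !prod_sign_card -exprD.
rewrite content_replace sj !ffunE !(card_others _ j) sj eqxx.
rewrite !(eq_sym y x) (negPf xy) eqxx /=.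
rewrite exprnP; congr (_ ^ _); lia.
Qed.

(* The identity holds site by site: for each i, the exponents on both sides
   have the same parity. *)
Lemma hop_sign_local s j x y m :
    s j = y -> x != y -> content (replace s j x) = m ->
    (single x -> forall i, i != j -> s i != x) ->
    (anti -> forall i, ~~ (minn x y < s i < maxn x y)%N) ->
  (\prod_(i | i != j)
     (-1) ^+ ((if (i < j)%N then (k <= y)%N && (s i == y)
               else (k <= x)%N && (s i == x)) : bool)) *
    inversion_sign (replace s j x) =
  hop_sign x y m * inversion_sign s *
  \prod_(i | i != j) (-1) ^+ ([&& single y, (i < j)%N & s i == y] : bool).
Proof.
move=> sj xy sm sx between.
rewrite inversion_sign_replace sj (hop_sign_prod sj xy sm) mulrA -!big_split /=.
rewrite mulrAC -big_split /=; congr (_ * _); apply: eq_bigr => i ij.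
rewrite -!signr_addb; congr (_ ^+ _).
have := between ^~ i; have := sx ^~ i ^~ ij.
move: xy ij; rewrite /single -!val_eqE /=.
(* Only the order of the letters, their position relative to k and the order of the two sites matter
   from here on. *)
move: (val (s i)) (val x) (val y) (val i) (val j) => a b c p q.
case: anti; case: (p < q)%N => /=; case: (ltngtP b c) => //= ?;
  case: (ltngtP a b) => //= ?; case: (ltngtP a c) => //= ?; lia.
Qed.

(* If a letter y of occupation at most 1 is created on top of another y, the
   two ways of doing so cancel. *)
Lemma sum_alternating (A : {set 'I_N}) : (#|A| <= 2)%N ->
  \sum_(j in A) \prod_(i | i != j) (-1) ^+ ((i < j)%N && (i \in A) : bool) =
  (if #|A| == 2%N then 0 else #|A|%:R) :> C.
Proof.
case: ifP => [/cards2P[p [q [pq ->]]] _ | A2 leA2].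
  rewrite big_setU1 ?inE //= big_set1 (bigD1 q) 1?eq_sym //=.
  rewrite big1 => [|i /andP[ip iq]]; last by rewrite !inE (negPf ip) (negPf iq)
    andbF.
  rewrite (bigD1 p) //= big1 => [|i /andP[iq ip]];
    last by rewrite !inE (negPf ip) (negPf iq) andbF.
  rewrite !inE !eqxx orbT !andbT !mulr1.
  by case: (ltngtP p q) pq => [||/val_inj->] //=;
    rewrite ?eqxx ?expr0 ?expr1 ?subrr ?addNr.
rewrite -sum1_card natr_sum; apply: eq_bigr => j jA; rewrite big1 // => i ij.
case: (boolP (i \in A)) => iA; last by rewrite andbF.
suff : (1 < #|A|)%N by move: A2 leA2; case: #|A| => [|[|[]]].
by apply/card_gt1P; exists i, j.
Qed.

(** A word of the target content has m_y + 1 sites with letter y. Their contributions agree when y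
    is not [single], which gives the factor; otherwise they alternate in sign, and two of them
    cancel exactly when the target is inadmissible. *)
Lemma op_t_closed x y m :
    x != y -> (single x -> m x <= 1) ->
    (anti -> forall z : 'I_n, (minn x y < z < maxn x y)%N -> m z = 0) ->
  op_t C k N x y (closed_vec m) =
  (hop_sign x y m * (m y + 1)%:~R) *: closed_vec (transfer x y m).
Proof.
move=> xy mx between; apply/ffunP=> s; rewrite op_tE [RHS]ffunE.
have [cs|cs] := boolP (content s == transfer x y m); last first.
  rewrite [X in _ *: X]ffunE (negPf cs) mul0r scaler0 big1 // => j /eqP sj.
  by rewrite ffunE content_replace sj -eq_transfer (negPf cs) mul0r mulr0.
have mE j : s j == y -> content (replace s j x) = m.
  by move=> /eqP sj; apply/eqP; rewrite content_replace sj -eq_transfer.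
rewrite [X in _ *: X]ffunE cs /=.
(* An over-occupied letter of m is not x, the only letter that loses occupation, so the target is
   inadmissible too and both sides vanish. *)
have [am|am] := boolP (admissible m); last first.
  have [z /andP[sz mz]] : exists z, single z && (1 < m z).
    move: am; rewrite negb_forall => /existsP[z].
    by rewrite negb_imply -ltNge => ?; exists z.
  have zx : (z == x) = false.
    by apply/eqP=> zx; move: mz; rewrite ltNge zx mx // -zx.
  have /negPf-> : ~~ admissible (transfer x y m).
    rewrite negb_forall; apply/existsP; exists z; rewrite negb_imply sz -ltNge.
    by rewrite ffunE zx subr0 (lt_le_trans mz) // lerDl.
  rewrite mul0r scaler0 big1 // => j _.
  by rewrite ffunE (negPf am) andbF mul0r mulr0.
pose A := [set j | s j == y].
have cA : #|A|%:Z = m y + 1.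
  have /ffunP/(_ y) := eqP cs; rewrite !ffunE eqxx (eq_sym y x) (negPf xy).
  by rewrite subr0.
transitivity (hop_sign x y m * inversion_sign s *
   \sum_(j in A) \prod_(i | i != j)
      (-1) ^+ ([&& single y, (i < j)%N & i \in A] : bool)).
  rewrite mulr_sumr [RHS](eq_bigl (fun j => s j == y)) => [|j];
    last by rewrite /A inE.
  apply: eq_bigr => j sj; rewrite ffunE (mE j sj) eqxx am mul1r.
  rewrite (hop_sign_local (eqP sj) xy (mE j sj)).
  - by under [in RHS]eq_bigr => i _ do rewrite /A inE.
  - move=> sx i ij; apply/negP=> six.
    have /ffunP/(_ x) := mE j sj; rewrite ffunE => mxE.
    have := mx sx; rewrite -mxE lez_nat leqNgt => /negP; apply.
    apply/card_gt1P; exists i, j; rewrite !inE !ffunE eqxx (negPf ij).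
    by split.
  - move=> an i; apply/negP=> bt; have := between an _ bt.
    have /ffunP/(_ (s i)) := mE j sj; rewrite ffunE => <- /eqP.
    rewrite eqz_nat cards_eq0 => /eqP/setP/(_ i); rewrite !inE ffunE.
    case: (i =P j) => [ij _|_]; last by rewrite eqxx.
    by move: bt; rewrite ij (eqP sj) gtn_min leq_max !ltnn ?orbF /=; lia.
rewrite /GRing.scale /= -cA.
case: (boolP (single y)) => sy /=; last first.
  under eq_bigr => j _ do rewrite big1 //.
  have -> : admissible (transfer x y m).
    apply/forallP=> z; apply/implyP=> sz; rewrite ffunE.
    have /negPf-> : z != y by apply: contraNneq sy => <-.
    rewrite addr0 (le_trans _ (implyP (forallP am z) sz)) // gerBl.
    by case: (z == x).
  by rewrite sumr_const mul1r mulrAC -pmulrn.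
have my : m y <= 1 := implyP (forallP am y) sy.
have A2 : (#|A| <= 2)%N by rewrite -lez_nat cA; lia.
rewrite sum_alternating //.
(* Two sites with y: the alternating sum is 0, and so is the target vector. *)
case: eqP => c2.
  have /negPf-> : ~~ admissible (transfer x y m).
    apply/negP=> /forallP/(_ y); rewrite sy !ffunE (eq_sym y) (negPf xy) eqxx.
    by rewrite subr0 -cA c2.
  by rewrite mul0r !mulr0.
have -> : admissible (transfer x y m).
  apply/forallP=> z; apply/implyP=> sz; rewrite ffunE.
  have := implyP (forallP am z) sz; case: (z =P y) => [->|_].
    by rewrite eq_sym (negPf xy) subr0 -[_ + _]cA lez_nat; move: c2 A2;
      case: #|A| => [|[|[|]]].
  by case: (z == x); rewrite addr0 ?subr0 //= => mz; apply: le_trans mz;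
    rewrite gerBl.
by rewrite mul1r mulrAC -pmulrn.
Qed.

Lemma op_h_closed x m : (k <= x)%N ->
  op_h C k N x (closed_vec m) = (-1) ^ m x *: closed_vec m.
Proof.
move=> kx; apply/ffunP=> s; rewrite op_hE kx [RHS]ffunE [X in _ *: X]ffunE.
rewrite [X in _ * X]ffunE; have [/eqP<-|_] := boolP (content s == m).
  rewrite prodrXr ffunE exprnP -sum1dep_card [in RHS]big_mkcond /=.
  by congr ((-1) ^ Posz _ * _).
by rewrite mul0r mulr0 scaler0.
Qed.

(** Replacing x by itself fixes the word. Each of the m_x sites contributes the same sign, coming
    from the m_x - 1 other letters x. *)
Lemma op_E_closed x m :
  op_E C k N x (closed_vec m) =
  ((m x)%:~R * (if (x < k)%N then 1 else (-1) ^ (m x - 1))) *: closed_vec m.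
Proof.
apply/ffunP=> s; rewrite /op_E op_tE [RHS]ffunE.
have sE j : s j == x -> replace s j x = s by move=> /eqP<-; exact: replace_id.
under eq_bigr => j sj do rewrite sE //.
rewrite -mulr_suml; have [/eqP cs|cs] := boolP (content s == m); last first.
  by rewrite [X in _ * X]ffunE [X in _ *: X]ffunE (negPf cs) mul0r mulr0
    scaler0.
congr (_ * _).
transitivity (\sum_(j | s j == x)
                (if (x < k)%N then 1 else (-1) ^ (m x - 1)) : C).
  apply: eq_bigr => j /eqP sj; case: ltnP => kx.
    by rewrite big1 // => i _; case: ifP.
  under eq_bigr => i _ do rewrite if_same /=.
  rewrite (prod_sign_card (fun i => s i == x)) exprnP -cs ffunE.
  by rewrite (card_others _ j) sj eqxx PoszD addrAC subrr add0r.
rewrite sumr_const -cs ffunE mulr_natl; congr (_ *+ _).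
by apply: eq_card => j; rewrite inE.
Qed.

(** * Exchange of neighbouring sites and the eigenvalue of H *)

Lemma closed_vec_repeat m s i i' :
  i != i' -> s i = s i' -> single (s i) -> closed_vec m s = 0.
Proof.
move=> ii' sii' si; rewrite ffunE.
case: andP => [[/eqP<- /forallP/(_ (s i))]|_]; last by rewrite mul0r.
rewrite si ffunE lez_nat leqNgt => /negP[].
by apply/card_gt1P; exists i, i'; rewrite !inE -sii' eqxx.
Qed.

(** An adjacent transposition alters only the pair it exchanges, and exactly one of the two orders
    of distinct letters is increasing. *)
Lemma inversion_sign_exchange s (j : 'I_N.-1) : s (lo j) != s (hi j) ->
  inversion_sign (exchange s j) = (-1) ^+ anti * inversion_sign s.
Proof.
set t := tperm (lo j) (hi j); move=> sj.
(* [h] selects the two ordered pairs formed by the sites j, j + 1; all other pairs keep their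
   order. *)
pose h (i i' : 'I_N) :=
  [&& i != i', (i == lo j) || (i == hi j) & (i' == lo j) || (i' == hi j)].
have tE i i' : [&& anti, (t i < t i')%N & (s i < s i')%N] =
   [&& anti, (i < i')%N & (s i < s i')%N] (+)
   [&& anti, h i i' & (s i < s i')%N].
  have ti (p : 'I_N) : val (t p) =
      (if val p == j then j.+1 else if val p == j.+1 then val j else p).
    rewrite /t; case: tpermP => [->|->|]; rewrite /= ?eqxx //.
      by rewrite gtn_eqF.
    by move=> /eqP; rewrite -val_eqE => /negPf->/eqP;
      rewrite -val_eqE => /negPf->.
  rewrite /h -!val_eqE !ti /=; case: anti => //=; case: (s i < s i')%N;
    last by rewrite !andbF.
  rewrite !andbT; move: (val i) (val i') (val j) => a b c.
  by do 4 case: eqP => ?; rewrite ?orbT ?orbF ?andbT ?andbF ?addbF ?addbT; lia.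
rewrite /inversion_sign (reindex_inj (@perm_inj _ t)).
under eq_bigr => i _ do rewrite (reindex_inj (@perm_inj _ t)).
transitivity (\prod_(i < N)
  ((\prod_(i' < N) (-1) ^+ ([&& anti, (i < i')%N & (s i < s i')%N] : bool)) *
   (\prod_(i' < N) (-1) ^+ ([&& anti, h i i' & (s i < s i')%N] : bool))) : C).
  apply: eq_bigr => i _; rewrite -big_split; apply: eq_bigr => i' _ /=.
  by rewrite !ffunE !tpermK tE signr_addb.
rewrite big_split mulrC; congr (_ * _).
have lohi := lo_neq_hi j.
rewrite (bigD1 (lo j)) //= [X in _ * X](bigD1 (hi j)) 1?eq_sym //=.
rewrite [X in _ * (_ * X)]big1 => [|i /andP[il ih]]; last first.
  by rewrite big1 // => i' _; rewrite /h (negPf il) (negPf ih) !andbF.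
rewrite (bigD1 (hi j)) //= big1 => [|i ih]; last first.
  by rewrite /h (negPf ih) orbF; case: (i =P lo j) => [->|];
    rewrite ?eqxx ?andbF.
rewrite (bigD1 (lo j)) //= big1 => [|i ih]; last first.
  by rewrite /h (negPf ih) /=; case: (i =P hi j) => [->|]; rewrite ?eqxx ?andbF.
rewrite /h !eqxx (eq_sym (hi j)) lohi orbT /= !mulr1.
case: anti; rewrite ?mulr1 //= -signr_addb.
by move: sj; rewrite -val_eqE /=; case: ltngtP.
Qed.

Lemma at_sites_rcheckE (j : 'I_N.-1) v s :
  at_sites j (rcheck C k n) v s =
  v (exchange s j) -
  ((k <= s (lo j))%N && (s (lo j) == s (hi j)))%:R *+ 2 * v s.
Proof.
have lohi := lo_neq_hi j.
rewrite lfunE /= ffunE /rcheck lfunE /= ffunE opp_lfunE !ffunE scale_lfunE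
  !ffunE.
rewrite sum_lfunE sum_ffunE; congr (_ - _).
  rewrite lfunE /= !ffunE; congr (v _); apply/ffunP=> i; rewrite !ffunE.
  case: tpermP => [->|->|/eqP/negPf-> /eqP/negPf->] //=.
    by rewrite eqxx.
  by rewrite eq_sym (negPf lohi) eqxx.
transitivity (2 * \sum_(x : 'I_n | (k <= x)%N)
    ((s (lo j) == x) && (s (hi j) == x))%:R * v s).
  congr (_ * _); apply: eq_bigr => x _.
  rewrite (@tensop_monomial _ _ _ _ _ _ (get2 j s)) => [|i z /negPf zi].
    rewrite ffunE big_ord_recl big_ord1 !mxE !ffunE /= !andbb -natrM mulnb.
    congr (_ * v _); apply/ffunP=> i; rewrite !ffunE /=.
    by case: (i =P lo j) => [->//|_]; case: (i =P hi j) => [->//|_].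
  rewrite mxE; case: eqP => //= <-; by rewrite zi.
rewrite -mulr_suml mulrA mulr_natl; congr (_ *+ 2 * _).
case: ltnP => ks; last first.
  rewrite (bigD1 (s (lo j))) //= eqxx eq_sym big1 ?addr0 // => x.
  by rewrite eq_sym => /andP[_ /negPf->].
rewrite big1 // => x kx.
by case: eqP => // sx; move: kx; rewrite -sx leqNgt ks.
Qed.

(** Each summand acts by the same sign. Distinct neighbours give the exchange sign. On equal
    neighbours the local operator is 1 for letters in [k] and -1 for the others; where this is the
    wrong sign, the letter is [single] and the coordinate is 0. *)
Lemma op_H_closed m :
  op_H C k n N (closed_vec m) = ((-1) ^+ anti * N.-1%:R) *: closed_vec m.
Proof.
rewrite /op_H sum_lfunE mulr_natr -scalerMnl.
suff H j : at_sites j (rcheck C k n) (closed_vec m) =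
    (-1) ^+ anti *: closed_vec m.
  by under eq_bigr => j _ do rewrite H; rewrite sumr_const card_ord.
apply/ffunP=> s; rewrite at_sites_rcheckE [RHS]ffunE.
have [sj|sj] := eqVneq (s (lo j)) (s (hi j)); last first.
  rewrite andbF mul0rn mul0r subr0 !ffunE content_exchange.
  by rewrite inversion_sign_exchange // mulrCA.
rewrite andbT exchange_id //; have := @closed_vec_repeat m s _ _ (lo_neq_hi j)
  sj.
rewrite /single; case: anti; case: ltnP => //= _.
- by move=> ->; rewrite // scaler0 mulr0 subr0.
- by move=> _; rewrite scaleN1r mulrDl mul1r opprD addrA subrr add0r.
- by move=> _; rewrite scale1r mul0rn mul0r subr0.
- by move=> ->; rewrite // scaler0 mulr0 subr0.
Qed.

Lemma closed_vec_neg m x : m x < 0 -> closed_vec m = 0.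
Proof.
move=> mx; apply/ffunP=> s; rewrite !ffunE.
by case: eqP mx => [<-|_ _]; rewrite ?ffunE ?mul0r.
Qed.

(** * Building u^+ and u^- from the reference state *)

Section HighestWeight.
Variable a : 'I_n.
Hypothesis nsingle_a : ~~ single a.
Hypothesis max_a : anti -> forall x, (x <= a)%N.

(** The c-fold iterate of [transfer a x]. *)
Definition shift x (c : nat) m : {ffun 'I_n -> int} :=
  [ffun z => m z - (z == a)%:Z *+ c + (z == x)%:Z *+ c].

Lemma ptens_closed :
  ptens (fun _ : 'I_N => delta_mx a 0) =
  closed_vec [ffun z => (z == a)%:Z *+ N].
Proof.
apply/ffunP=> s; rewrite !ffunE.
under eq_bigr => i _ do rewrite mxE andbT.
have [/forallP sa|] := boolP [forall i, s i == a]; last first.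
  rewrite negb_forall => /existsP[i /negPf si].
  rewrite (bigD1 i) //= si mul0r; case: eqP => [/ffunP/(_ (s i))|_];
    last by rewrite mul0r.
  rewrite !ffunE si mul0rn => /eqP; rewrite eqz_nat cards_eq0.
  by move=> /eqP/setP/(_ i); rewrite !inE eqxx.
rewrite big1 => [|i _]; last by rewrite sa.
have -> : content s == [ffun z => (z == a)%:Z *+ N].
  apply/eqP/ffunP=> z; rewrite !ffunE.
  case: (z =P a) => [->|/eqP za].
    rewrite (_ : [set i | _] = setT) ?cardsT ?card_ord ?natz //.
    by apply/setP=> i; rewrite !inE sa.
  rewrite (_ : [set i | _] = set0) ?cards0 ?mul0rn //.
  by apply/setP=> i; rewrite !inE (eqP (sa i)) eq_sym (negPf za).
have -> : admissible [ffun z => (z == a)%:Z *+ N].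
  apply/forallP=> z; apply/implyP=> sz; rewrite ffunE.
  have /negPf-> : z != a by apply: contraNneq nsingle_a => <-.
  by rewrite mul0rn.
rewrite mul1r /inversion_sign big1 // => i _; rewrite big1 // => j _.
by rewrite (eqP (sa i)) (eqP (sa j)) ltnn !andbF.
Qed.

(** The successive occupation numbers 1, ..., c of x multiply to c!. By [max_a] no hop sign appears,
    and by [nsingle_a] the occupation of a needs no bound. *)
Lemma iter_op_t_closed x c m (b : C) :
    x != a -> m x = 0 -> (anti -> forall z : 'I_n, (x < z < a)%N -> m z = 0) ->
  iter c (op_t C k N a x) (b *: closed_vec m) =
  (b * c`!%:R) *: closed_vec (shift x c m).
Proof.
move=> xa mx between; elim: c => [|c IHc] /=.
  rewrite mulr1; congr (_ *: closed_vec _); apply/ffunP=> z.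
  by rewrite ffunE subr0 addr0.
rewrite IHc linearZ /= op_t_closed; first last.
- move=> an z; rewrite (minn_idPr (max_a an x)) (maxn_idPl (max_a an x)) => zx.
  rewrite ffunE (between an) //.
  have [/negPf-> /negPf->] : z != x /\ z != a by rewrite -!val_eqE /=; lia.
  by rewrite !mul0rn subr0 addr0.
- by move=> sa; have := nsingle_a; rewrite sa.
- by rewrite eq_sym.
rewrite scalerA /hop_sign; have -> : anti && (a < x)%N = false.
  by case: (boolP anti) => //= an; rewrite ltnNge max_a.
rewrite mul1r ffunE mx eqxx (negPf xa) mul0rn subr0 add0r.
congr (_ *: closed_vec _).
  by rewrite -mulrA natz -(PoszD c 1) addn1 -pmulrn factS natrM [X in _ *
    X]mulrC.
by apply/ffunP=> z; rewrite !ffunE !mulrSr; lia.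
Qed.

(** The invariant on m: apart from a, no letter from the smallest pending one upwards is occupied.
    Increasing order preserves it, and it keeps the letters between x and a absent when x acts. *)
Lemma foldl_op_t_closed (M : 'I_n -> nat) l m (b : C) :
    sorted (fun x y : 'I_n => (x < y)%N) l -> a \notin l ->
    (forall z, z != a -> has (fun x : 'I_n => (x <= z)%N) l -> m z = 0) ->
  foldl (fun v x => iter (M x) (op_t C k N a x) v) (b *: closed_vec m) l =
  (b * \prod_(x <- l) (M x)`!%:R) *:
    closed_vec [ffun z => if z == a then m a - (\sum_(x <- l) M x)%:Z
                          else if z \in l then (M z)%:Z else m z].
Proof.
elim: l m b => [|x l IHl] m b /=.
  move=> _ _ _; rewrite big_nil mulr1 big_nil; congr (_ *: closed_vec _).
  by apply/ffunP=> z; rewrite ffunE subr0; case: eqP => [->|].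
move=> xl; rewrite inE negb_or eq_sym => /andP[xa al] m0.
have xmin : all (fun y : 'I_n => (x < y)%N) l.
  by apply: order_path_min xl => u v w; exact: ltn_trans.
have xNl : x \notin l by apply/negP=> /(allP xmin); rewrite ltnn.
have mx : m x = 0 by apply: m0; rewrite ?leqnn.
rewrite iter_op_t_closed //; last first.
  move=> an z /andP[xz za]; apply: m0; last by rewrite (ltnW xz).
  by rewrite -val_eqE ltn_eqF.
rewrite IHl ?(path_sorted xl) //; last first.
  move=> z za /hasP[y yl yz]; have xz := leq_trans (allP xmin y yl) yz.
  rewrite ffunE (negPf za) mul0rn subr0 m0 // ?(ltnW xz) //.
  by rewrite -val_eqE gtn_eqF // mul0rn.
rewrite -mulrA !big_cons; congr (_ *: closed_vec _); apply/ffunP=> z.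
rewrite !ffunE inE (eq_sym a x) (negPf xa) eqxx PoszD natz mul0rn addr0.
case: (z =P a) => [_|_]; first by rewrite opprD addrA.
case: (z =P x) => [->|_] /=; last by rewrite mul0rn subr0 addr0.
by rewrite (negPf xNl) mx natz mul0rn subr0 add0r.
Qed.

(** * Factorial normalisation and the action on u^+ and u^- *)

Definition fact_weight m : C := \prod_(x | x != a) (`|m x|%N)`!%:R.

Lemma uvec_closed m : \sum_x m x = N%:Z ->
  uvec C k N a m = fact_weight m *: closed_vec m.
Proof.
move=> sm; rewrite /uvec; case: forallP => [m0|/forallP]; last first.
  rewrite negb_forall => /existsP[x]; rewrite -ltNge => /closed_vec_neg->.
  by rewrite scaler0.
rewrite ptens_closed -[closed_vec _]scale1r.
rewrite (foldl_op_t_closed (fun x => `|m x|%N)).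
- rewrite mul1r big_filter big_enum_cond /=.
  congr (_ *: closed_vec _); apply/ffunP=> z; rewrite !ffunE eqxx natz.
  rewrite mem_filter mem_enum inE andbT.
  case: (z =P a) => [->|_]; last by rewrite /= gez0_abs.
  (* Since the total is N, the letter a is left with occupation m_a. *)
  rewrite big_filter big_enum_cond /= -sm (bigD1 a) //= -[RHS]addr0 -addrA.
  congr (_ + _); apply/eqP; rewrite subr_eq0; apply/eqP.
  rewrite (big_morph Posz PoszD (erefl _)).
  by apply: eq_bigr => x _; rewrite gez0_abs.
- apply: sorted_filter => [x y z|]; first exact: ltn_trans.
  by have := iota_ltn_sorted 0 n; rewrite -val_enum_ord sorted_map.
- by rewrite mem_filter eqxx.
- by move=> z /negPf za _; rewrite ffunE za mul0rn.
Qed.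

(** Turns the generic factor m_y + 1 into m_x, by m_x! m_y! (m_y + 1) = m_x (m_x - 1)! (m_y + 1)!.
    The letter a carries no factorial, hence the exceptional coefficients at the ends. *)
Lemma fact_weight_transfer x y m :
    x != y -> (forall z, 0 <= m z) -> 0 < m x ->
  fact_weight m * (m y + 1)%:~R =
  (if x == a then 1 else (m x)%:~R) * (if y == a then (m y + 1)%:~R else 1) *
    fact_weight (transfer x y m).
Proof.
rewrite eq_sym => yx m0 mx.
pose w (M : {ffun 'I_n -> int}) z : C := if z == a then 1 else (`|M z|%N)`!%:R.
have E M : fact_weight M =
    w M x * (w M y * \prod_(z | (z != x) && (z != y)) w M z).
  rewrite /fact_weight big_mkcond (bigD1 x) //= (bigD1 y) //=.
  by rewrite !if_neg; under eq_bigr => z _ do rewrite if_neg.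
rewrite !{}E /w.
set P := \prod_(_ | _) _; set Q := \prod_(_ | _) _.
have -> : Q = P.
  apply: eq_bigr => z /andP[zx zy]; rewrite ffunE (negPf zx) (negPf zy).
  by rewrite subr0 addr0.
rewrite !ffunE !eqxx (negPf yx) (eq_sym x y) (negPf yx) /=.
rewrite addr0 subr0.
have [p ->] : exists p, m x = p.+1 by exists `|m x|.-1; lia.
have [q ->] : exists q : nat, m y = q by exists `|m y|%N; rewrite gez0_abs.
have q1 : q%:Z + 1 = q.+1%:Z by lia.
have -> : `|p.+1%:Z - 1|%N = p by lia.
rewrite q1 -!pmulrn !absz_nat !factS !natrM.
by case: (x == a); case: (y == a); ring.
Qed.

(* [b] is only constrained where the right-hand side does not vanish, as the
   coefficients of the theorem differ from the generic one elsewhere. *)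
Lemma op_t_uvec x y m (b : C) :
    \sum_z m z = N%:Z -> (forall z, 0 <= m z) -> x != y ->
    (single x -> m x <= 1) ->
    (anti -> forall z : 'I_n, (minn x y < z < maxn x y)%N -> m z = 0) ->
    (0 < m x -> (single y -> m y = 0) ->
     b = hop_sign x y m * (if x == a then 1 else (m x)%:~R) *
           (if y == a then (m y + 1)%:~R else 1)) ->
  op_t C k N x y (uvec C k N a m) = b *: uvec C k N a (transfer x y m).
Proof.
move=> sm m0 xy mx between bE.
rewrite !uvec_closed ?sum_transfer // linearZ /= op_t_closed // !scalerA.
have [mx0|mx_gt0] := leP (m x) 0.
  rewrite [closed_vec _](@closed_vec_neg _ x) ?scaler0 //.
  by rewrite ffunE eqxx (negPf xy); move: mx0; lia.
(* If y is [single] and already present, the target is inadmissible and any b will do. *)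
have [/andP[sy my]|my] := boolP (single y && (m y != 0)).
  suff -> : closed_vec (transfer x y m) = 0 by rewrite !scaler0.
  have my1 : 1 < transfer x y m y.
    rewrite ffunE eqxx eq_sym (negPf xy); have := m0 y; move: my; lia.
  apply/ffunP=> s; rewrite !ffunE; case: andP => [[_ /forallP/(_ y)]|_].
    by rewrite sy leNgt my1.
  by rewrite mul0r.
rewrite bE //; last by move=> sy; move: my; rewrite sy negbK => /eqP.
by rewrite mulrCA (fact_weight_transfer xy m0 mx_gt0) !mulrA.
Qed.

Lemma op_H_uvec m : \sum_x m x = N%:Z ->
  op_H C k n N (uvec C k N a m) = ((-1) ^+ anti * N.-1%:R) *: uvec C k N a m.
Proof.
by move=> sm; rewrite uvec_closed // linearZ /= op_H_closed !scalerA mulrC.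
Qed.

Lemma op_h_uvec x m : \sum_x m x = N%:Z -> (k <= x)%N ->
  op_h C k N x (uvec C k N a m) = (-1) ^ m x *: uvec C k N a m.
Proof.
by move=> sm kx; rewrite uvec_closed // linearZ /= op_h_closed // !scalerA
  mulrC.
Qed.

Lemma op_E_uvec x m : \sum_x m x = N%:Z ->
  op_E C k N x (uvec C k N a m) =
  ((m x)%:~R * (if (x < k)%N then 1 else (-1) ^ (m x - 1))) *: uvec C k N a m.
Proof.
by move=> sm; rewrite uvec_closed // linearZ /= op_E_closed !scalerA mulrC.
Qed.

End HighestWeight.
End ClosedForm.
End Coordinates.

(** * Specialisation to the first and last letters, and comparison of coefficients *)

Theorem theorem3p3 (R : realType) (k n N : nat)
    (hk : (1 <= k)%N) (hkn : (k < n)%N) (hN : (2 <= N)%N)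
    (m : {ffun 'I_n -> int}) :
  (admplus k N m ->
   let u := @uplus (complex R) k n N hkn in
   op_H (complex R) k n N (u m) = (N.-1)%:R *: u m /\
   [/\ forall x : 'I_n, (k <= x)%N ->
         op_h (complex R) k N x (u m) = (-1) ^ m x *: u m,
       forall x : 'I_n, (x < k)%N ->
         op_E (complex R) k N x (u m) = (m x)%:~R *: u m,
       forall x : 'I_n, (k <= x)%N ->
         op_E (complex R) k N x (u m) =
         ((m x)%:~R * (-1) ^ (m x - 1)) *: u m,
       forall x : 'I_n.-1,
         op_e (complex R) k N x (u m) =
         bplus (complex R) k m x *: u (transfer (lo x) (hi x) m)
     & forall x : 'I_n.-1,
         op_f (complex R) k N x (u m) =
         cplus (complex R) m x *: u (transfer (hi x) (lo x) m)])
  /\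
  (admminus k N m ->
   let u := @uminus (complex R) k n N hkn in
   op_H (complex R) k n N (u m) = - (N.-1)%:R *: u m /\
   [/\ forall x : 'I_n, (k <= x)%N ->
         op_h (complex R) k N x (u m) = (-1) ^ m x *: u m,
       forall x : 'I_n, (x < k)%N ->
         op_E (complex R) k N x (u m) = (m x)%:~R *: u m,
       forall x : 'I_n, (k <= x)%N ->
         op_E (complex R) k N x (u m) =
         ((m x)%:~R * (-1) ^ (m x - 1)) *: u m,
       forall x : 'I_n.-1,
         op_e (complex R) k N x (u m) =
         bminus (complex R) k m x *: u (transfer (lo x) (hi x) m)
     & forall x : 'I_n.-1,
         op_f (complex R) k N x (u m) =
         cminus (complex R) m x *: u (transfer (hi x) (lo x) m)]).
Proof.
have between (x : 'I_n.-1) (z : 'I_n) :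
    ~~ (minn (lo x) (hi x) < z < maxn (lo x) (hi x))%N.
  by rewrite /=; lia.
have hilo (x : 'I_n.-1) : hi x != lo x by rewrite eq_sym lo_neq_hi.
split=> -[sm adm] u.
  have single_le x : single k false x -> m x <= 1.
    by rewrite /single leqNgt => /negPf kx; have /andP[_] := adm x; rewrite kx.
  have m0 z : 0 <= m z by have /andP[] := adm z.
  have na : ~~ single k false (ord_first hkn) by rewrite /single -ltnNge.
  have ma : false -> forall x : 'I_n, (x <= ord_first hkn)%N by [].
  split; first by rewrite (op_H_uvec _ na ma) // mul1r.
  split=> x.
  - exact: (op_h_uvec _ na ma).
  - by move=> xk; rewrite [LHS](op_E_uvec _ na ma) // xk mulr1.
  - by move=> kx; rewrite [LHS](op_E_uvec _ na ma) // ltnNge kx.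
  - apply: (op_t_uvec na ma sm m0 (lo_neq_hi x) (single_le _)) => //.
    (* If x + 1 lies in X_k^+ it is [single], so its occupation may be taken to be 0 and the sign in
       b^+ is 1. *)
    move=> mlo; rewrite /hop_sign /single /bplus -!val_eqE /= !mul1r mulr1.
    case: ifP => // _; case: ltnP => //= kx /(_ isT)->.
    by rewrite expr0z mul1r.
  - apply: (op_t_uvec na ma sm m0 (hilo x) (single_le _)) => //.
    move=> _ _; rewrite /hop_sign /cplus -!val_eqE /= mul1r.
    by case: ifP => _; rewrite ?mulr1 // mulrC.
have single_le x : single k true x -> m x <= 1.
  by rewrite /single => kx; have /andP[_] := adm x; rewrite kx.
have m0 z : 0 <= m z by have /andP[] := adm z.
have na : ~~ single k true (ord_last hkn) by rewrite /single /= -leqNgt; lia.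
have ma : true -> forall x : 'I_n, (x <= ord_last hkn)%N.
  by move=> _ x /=; have := ltn_ord x; lia.
split; first by rewrite (op_H_uvec _ na ma) // expr1 mulN1r.
split=> x.
- exact: (op_h_uvec _ na ma).
- by move=> xk; rewrite [LHS](op_E_uvec _ na ma) // xk mulr1.
- by move=> kx; rewrite [LHS](op_E_uvec _ na ma) // ltnNge kx.
- apply: (op_t_uvec na ma sm m0 (lo_neq_hi x) (single_le _)) => //.
    by move=> _ z zb; have := between x z; rewrite zb.
  have lox : (lo x == ord_last hkn) = false.
    by rewrite -val_eqE /=; have := ltn_ord x; lia.
  move=> mlo; rewrite lox /hop_sign /single /bminus -!val_eqE /= ltnSn.
  rewrite (addrAC (m (lo x))) (addrC (m (lo x))).
  (* For x + 1 in [k] both letters are [single]: m_x = 1 and m_(x+1) = 0 make the hop sign trivial,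
     which is why b^- has no sign there. *)
  have sx1 : (x.+1 < k)%N -> m (lo x) = 1.
    by move=> xk; have := single_le (lo x) (ltnW xk); move: mlo; lia.
  case: ifP => [_ _|_]; first by [].
  case: ltnP => [xk /(_ isT) mhi|_ _]; last by rewrite mulr1.
  by rewrite mhi (sx1 xk) add0r subrr expr0z mulr1 mul1r.
- apply: (op_t_uvec na ma sm m0 (hilo x) (single_le _)) => //.
    by move=> _ z; rewrite minnC maxnC => zb; have := between x z; rewrite zb.
  have lox : (lo x == ord_last hkn) = false.
    by rewrite -val_eqE /=; have := ltn_ord x; lia.
  (* The first index of f_x is the larger letter, so its hop sign is 1. *)
  move=> _ _; rewrite lox /hop_sign /cminus -!val_eqE /= ltnNge leqnSn /=.
  by rewrite mul1r mulr1.
Qed.
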